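(* Let $F$ and $G$ be two fixed distribution functions. For any $z\in(-\infty,\infty)$: (i) There exists a copula $C_{t^*}$, dependent only on the value $t^*$ of $\tau_W(F,G)$ at $z-$, such that $$\sigma_{C_{t^*}}(F,G)(z-)=\tau_W(F,G)(z-)=t^*.$$ In other words, the lower bound on $P(X+Y<z)$ is always achievable. (ii) We have $\tau_W(F,G)(z)=\inf_{C}\sigma_C(F,G)(z)$, where the infimum is taken over all copulas $C$. In other words, $t=\tau_W(F,G)(z)$ is the infimum of $P(X+Y\le z)$ over all possible joint distributions of $X,Y$ with margins $F,G$. (iii) If $t^*=\tau_W(F,G)(z-)<t=\tau_W(F,G)(z)$, then there exists a copula $C_t$, dependent only on $t$, such that $$\sigma_{C_t}(F,G)(z)=\tau_W(F,G)(z).$$ That is, the lower bound on $P(X+Y\le z)$ can be achieved by $C_t$ when $\tau_W(F,G)(z-)<\tau_W(F,G)(z)$. In this case also $\tau_W(F,G)(z)=\min_C\sigma_C(F,G)(z)$, where the minimum is taken over all copulas. (iv) If there is no copula $C^*$ such that $\sigma_{C^*}(F,G)(z)=\tau_W(F,G)(z)$, then $\tau_W(F,G)(z)=\tau_W(F,G)(z-)$. That is, if the lower bound on $P(X+Y\le z)$ is not achievable by any joint distribution, then the lower bounds for $P(X+Y\le z)$ and $P(X+Y<z)$ must be the same.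
   Context: Distribution functions are right-continuous: $F(x)=P(X\le x)$, $G(y)=P(Y\le y)$, where $X,Y$ are real random variables with fixed margins $F,G$ and unspecified joint distribution. For a function $f$ of a real variable, $f(z-)$ denotes its left-hand limit at $z$. A (two-dimensional) copula is a function $C:[0,1]^2\to[0,1]$ with $C(a,0)=C(0,a)=0$, $C(a,1)=C(1,a)=a$ for all $a\in[0,1]$, and $C(a_2,b_2)-C(a_1,b_2)-C(a_2,b_1)+C(a_1,b_1)\ge 0$ whenever $a_1\le a_2$, $b_1\le b_2$ in $[0,1]$. For a copula $C$ and real $z$, $\sigma_C(F,G)(z)=\iint_{x+y\le z}dC(F(x),G(y))$, i.e. $\sigma_C(F,G)(z)=P(X+Y\le z)$ when $(X,Y)$ has joint distribution function $H(x,y)=C(F(x),G(y))$; correspondingly $\sigma_C(F,G)(z-)=P(X+Y<z)$. The Makarov lower bound is $\tau_W(F,G)(z)=\sup_{x+y=z}\max(F(x)+G(y)-1,0)$, the supremum being over real $x,y$. The lower bound on $P(X+Y\le z)$ is $\tau_W(F,G)(z)$ and the lower bound on $P(X+Y<z)$ is $\tau_W(F,G)(z-)$. ''Achievable'' means attained under some joint distribution with margins $F,G$. The copulas $C_{t^*}$ and $C_t$ are members of the family, indexed by $t\in[0,1]$, $$C_t(u,v)=\begin{cases}\max(u+v-1,t), & (u,v)\in[t,1]\times[t,1],\\ \min(u,v), & \text{otherwise.}\end{cases}$$ ''Dependent only on $t$'' means that the copula is a function of the number $t$ alone, the same for all $F,G,z$ giving that value. *)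

(* Defs.v *)
From HB Require Import structures.
From mathcomp Require Import all_boot all_order all_algebra.
From mathcomp Require Import all_classical all_reals all_analysis.
Import Order.TTheory GRing.Theory Num.Theory.
Import numFieldNormedType.Exports.

Set Implicit Arguments.
Unset Strict Implicit.
Unset Printing Implicit Defensive.

Local Open Scope classical_set_scope.
Local Open Scope ring_scope.

(* A distribution function is an element of [cumulativeBounded 0 1]:
   nondecreasing, right-continuous, with limit 0 at -oo and 1 at +oo. *)

Section defs.
Context {R : realType}.

(* Functions on the unit square are total functions of two reals; only their
   values on the square are constrained, and only those are ever used. *)
Record is_copula (C : R -> R -> R) : Prop := IsCopula {
  copula_range : forall a b, 0 <= a <= 1 -> 0 <= b <= 1 -> 0 <= C a b <= 1 ;
  copula_0 : forall a, 0 <= a <= 1 -> C a 0 = 0 /\ C 0 a = 0 ;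
  copula_1 : forall a, 0 <= a <= 1 -> C a 1 = a /\ C 1 a = a ;
  copula_2increasing : forall a1 a2 b1 b2,
    0 <= a1 -> a1 <= a2 -> a2 <= 1 -> 0 <= b1 -> b1 <= b2 -> b2 <= 1 ->
    0 <= C a2 b2 - C a1 b2 - C a2 b1 + C a1 b1 }.

Definition copula_t (t u v : R) : R :=
  if (t <= u <= 1) && (t <= v <= 1) then Num.max (u + v - 1) t
  else Num.min u v.

Definition has_joint_cdf (P : probability (R * R)%type R) (H : R -> R -> R) :=
  forall x y, P (`]-oo, x] `*` `]-oo, y]) = (H x y)%:E.

Definition has_margins (P : probability (R * R)%type R) (F G : R -> R) :=
  (forall x, P (`]-oo, x] `*` setT) = (F x)%:E) /\
  (forall y, P (setT `*` `]-oo, y]) = (G y)%:E).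

(* The Lebesgue-Stieltjes probability dH on the plane, i.e. the unique Borel
   probability with joint distribution function H. It exists whenever H is a
   joint distribution function, in particular for H(x,y) = C(F(x),G(y)) with
   C a copula and F, G distribution functions; the default point mass is only
   returned for an H that is not a joint distribution function. *)
Definition joint_law (H : R -> R -> R) : probability (R * R)%type R :=
  xget (\d_((0, 0) : R * R) : probability (R * R)%type R)
       [set P | has_joint_cdf P H].

Definition sigma (C : R -> R -> R) (F G : R -> R) (z : R) : R :=
  fine (joint_law (fun x y => C (F x) (G y)) [set p | p.1 + p.2 <= z]).

Definition tau_W (F G : R -> R) (z : R) : R :=
  sup [set Num.max (F p.1 + G p.2 - 1) 0 | p in [set p : R * R | p.1 + p.2 = z]].

Definition left_limit (f : R -> R) (z : R) : R := lim (f x @[x --> z^'-]).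

End defs.

(* Main.v *)
Require Import Defs.
From HB Require Import structures.
From mathcomp Require Import all_boot all_order all_algebra.
From mathcomp Require Import all_classical all_reals all_analysis.
From mathcomp Require Import measurable_realfun lra.
Import Order.TTheory GRing.Theory Num.Theory.
Import numFieldNormedType.Exports.
Local Open Scope classical_set_scope.
Local Open Scope ring_scope.
Set Implicit Arguments.
Unset Strict Implicit.
Unset Printing Implicit Defensive.

(** The lower bound is elementary: P(X <= x, Y <= y) >= F(x) + G(y) - 1 for any
    joint law with margins F and G, so P(X + Y <= z) is at least every
    F(x) + G(y) - 1 with x + y = z ([tau_W_le_prob]).

    For sharpness, let (X, Y) have joint distribution function
    H(x, y) = C_s(F(x), G(y)). On the region F(x) + G(y) - 1 <= s the copula
    C_s coincides with min(u, v, s), so there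
    H(x, y) = min(min(F(x), s), min(G(y), s)). Hence, of any two lower-left
    quadrants with corners in this region, one is almost surely contained in
    the other: if the corners are not ordered, the intersection is the quadrant
    of another corner of the region, and its mass is the smaller of the two
    masses. A countable family of sets that are almost surely nested, each of
    mass at most s, has a union of mass at most s ([measure_bigcup_chain]), so
    any event covered by countably many such quadrants has probability at most
    s ([extremal_bigcup]). What remains is to exhibit coverings.
    - For s = tau_W(z-), the rational corners strictly below the line x + y = z
      cover X + Y < z ([extremal_lt]).
    - For s > tau_W(z), right-continuity of F and G moves any (x, y) with
      x + y <= z to a larger rational corner with F + G - 1 <= s, so X + Y <= z
      is covered ([extremal_le]); letting s decrease to tau_W(z) identifies the
      infimum.
    - For s = tau_W(z) > tau_W(z-), the same argument covers all points except
      those dominated by a point (x, z - x) with F(x) + G(z - x) - 1 = tau_W(z).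
      At such an x the function F jumps by at least tau_W(z) - tau_W(z-), so
      there are countably many of them and their quadrants complete the
      covering ([extremal_le_jump]).

    All this speaks of the law with distribution function C(F(x), G(y)), which
    must be shown to exist for every copula C. For fixed y, let nu_y be the
    Lebesgue-Stieltjes measure of C(F(.), G(y)). By the 2-increasing property
    these measures increase with y and are dominated by the law of F, so they
    have densities f_y with respect to it, almost everywhere nondecreasing in y
    along the rationals. Taking (x, w) distributed according to the law of F
    times Lebesgue measure, and y the first level q with 0 <= w < f_q(x), gives
    a random pair (x, y) with the prescribed distribution function
    ([coupling_of_monotone_family], [copula_law_exists]). *)

(** * The copulas C_t *)

(** The innermost minima and maxima are split first, so that the hypotheses
    produced by the case analyses are linear. *)
Ltac split_minmax :=
  repeat match goal with
  | |- context [Num.min ?a ?b] =>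
      lazymatch constr:((a, b)) with
      | context [Num.min _ _] => fail
      | context [Num.max _ _] => fail
      | _ => case: (lerP a b) => ?
      end
  | |- context [Num.max ?a ?b] =>
      lazymatch constr:((a, b)) with
      | context [Num.min _ _] => fail
      | context [Num.max _ _] => fail
      | _ => case: (lerP a b) => ?
      end
  end.

Section copulas.
Context {R : realType}.
Implicit Types (C : R -> R -> R) (t u v : R).

(** This form makes the 2-increasing property visible, as a sum of two
    2-increasing functions; it also shows that C_t is min(u, v, t) where
    u + v - 1 <= t. *)
Lemma copula_tE t u v : 0 <= t <= 1 -> 0 <= u <= 1 -> 0 <= v <= 1 ->
  copula_t t u v =
  Num.min (Num.min u t) (Num.min v t) + Num.max (u + v - 1 - t) 0.
Proof.
move=> /andP[t0 t1] /andP[u0 u1] /andP[v0 v1]; rewrite /copula_t u1 v1 !andbT.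
by case: (lerP t u) => tu; case: (lerP t v) => tv /=; split_minmax; lra.
Qed.

Lemma min_2increasing (p q r s : R) : p <= q -> r <= s ->
  0 <= Num.min q s - Num.min p s - Num.min q r + Num.min p r.
Proof. by move=> pq rs; split_minmax; lra. Qed.

(** Convexity of the positive part, evaluated along a sum. *)
Lemma posp_2increasing (p h k : R) : 0 <= h -> 0 <= k ->
  0 <= Num.max (p + h + k) 0 - Num.max (p + k) 0 - Num.max (p + h) 0 + Num.max p 0.
Proof. by move=> h0 k0; split_minmax; lra. Qed.

Lemma copula_t_copula t : 0 <= t <= 1 -> is_copula (copula_t t).
Proof.
move=> t01; have /andP[t0 t1] := t01; split.
- move=> a b /andP[a0 a1] /andP[b0 b1]; rewrite /copula_t.
  case: ifPn => [_|_]; first by split_minmax; lra.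
  by split_minmax; lra.
- move=> a /andP[a0 a1]; rewrite /copula_t a1 ler01 !andbT.
  by split; case: ifPn => [/andP[? ?]|_]; split_minmax; lra.
- move=> a /andP[a0 a1]; rewrite /copula_t a1 lexx t1 !(andbT, andTb).
  by split; case: ifPn => ?; split_minmax; lra.
- move=> a1 a2 b1 b2 a10 a12 a21 b10 b12 b21.
  rewrite !copula_tE//; try by apply/andP; split; lra.
  have mon (a b : R) : a <= b -> Num.min a t <= Num.min b t.
    by move=> ab; rewrite le_min !ge_min lexx ab orbT.
  have mi := min_2increasing (mon _ _ a12) (mon _ _ b12).
  have h0 : 0 <= a2 - a1 by lra.
  have k0 : 0 <= b2 - b1 by lra.
  have := posp_2increasing (a1 + b1 - 1 - t) h0 k0.
  rewrite (_ : _ + (a2 - a1) + (b2 - b1) = a2 + b2 - 1 - t); last lra.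
  rewrite (_ : _ + (b2 - b1) = a1 + b2 - 1 - t); last lra.
  rewrite (_ : _ + (a2 - a1) = a2 + b1 - 1 - t); last lra.
  by clear -mi; lra.
Qed.

(** Both coordinates at once: the 2-increasing inequality on rectangles resting on
    an axis, where the copula vanishes. *)
Lemma copula_nondecreasing C a1 a2 b1 b2 : is_copula C -> 0 <= a1 -> a1 <= a2 -> a2 <= 1 ->
  0 <= b1 -> b1 <= b2 -> b2 <= 1 -> C a1 b1 <= C a2 b2.
Proof.
move=> cC a10 a12 a21 b10 b12 b21.
have a1in : 0 <= a1 <= 1 by apply/andP; split; lra.
have b2in : 0 <= b2 <= 1 by apply/andP; split; lra.
have := copula_2increasing cC a10 a12 a21 (lexx 0) (le_trans b10 b12) b21.
have := copula_2increasing cC (lexx 0) a10 (le_trans a12 a21) b10 b12 b21.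
have a2in : 0 <= a2 <= 1 by apply/andP; split; lra.
have b1in : 0 <= b1 <= 1 by apply/andP; split; lra.
rewrite (copula_0 cC a1in).1 (copula_0 cC a2in).1.
by rewrite (copula_0 cC b1in).2 (copula_0 cC b2in).2; lra.
Qed.

(** The 2-increasing inequality on rectangles reaching the opposite side of the
    square, where the copula is the other coordinate. *)
Lemma copula_lipschitz C a1 a2 b1 b2 : is_copula C -> 0 <= a1 -> a1 <= a2 -> a2 <= 1 ->
  0 <= b1 -> b1 <= b2 -> b2 <= 1 -> C a2 b2 - C a1 b1 <= (a2 - a1) + (b2 - b1).
Proof.
move=> cC a10 a12 a21 b10 b12 b21.
have a1in : 0 <= a1 <= 1 by apply/andP; split; lra.
have b2in : 0 <= b2 <= 1 by apply/andP; split; lra.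
have := copula_2increasing cC a10 a12 a21 (le_trans b10 b12) b21 (lexx 1).
have := copula_2increasing cC a10 (le_trans a12 a21) (lexx 1) b10 b12 b21.
have a2in : 0 <= a2 <= 1 by apply/andP; split; lra.
have b1in : 0 <= b1 <= 1 by apply/andP; split; lra.
rewrite (copula_1 cC a1in).1 (copula_1 cC a2in).1.
by rewrite (copula_1 cC b1in).2 (copula_1 cC b2in).2; lra.
Qed.

End copulas.

(** * Comparison of measures and of densities *)

Section measure_comparison.
Context d (T : measurableType d) (R : realType).
Local Open Scope ereal_scope.

Lemma le_measure_negligible (mu : {measure set T -> \bar R}) (A B : set T) :
  measurable A -> measurable B -> mu.-negligible (A `\` B) -> mu A <= mu B.
Proof.
move=> mA mB nAB; rewrite (measureDI mu mA mB).
rewrite (iffLR (negligibleP _ (measurableD mA mB)) nAB) add0e.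
by apply: le_measure; rewrite ?inE//; exact: measurableI.
Qed.

(** On the set where g < f the integral of the positive function f - g is at
    most 0, which forces this set to be null. *)
Lemma density_mono (mu : {measure set T -> \bar R}) (f g : T -> \bar R) :
  mu.-integrable setT f -> mu.-integrable setT g ->
  (forall A, measurable A -> \int[mu]_(x in A) f x <= \int[mu]_(x in A) g x) ->
  mu [set x | g x < f x] = 0.
Proof.
move=> intf intg fg; set E := [set x | g x < f x].
have [mf _] := integrableP _ _ _ intf; have [mg _] := integrableP _ _ _ intg.
have mE : measurable E by rewrite -[E]setTI; exact: measurable_lte.
have intfE : mu.-integrable E f by exact: integrableS intf.
have intgE : mu.-integrable E g by exact: integrableS intg.
have h0 x : E x -> 0 < f x - g x by rewrite sube_gt0.
have : \int[mu]_(x in E) `|f x - g x| = 0.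
  under eq_integral => x /[!inE] /h0/ltW fgx do rewrite gee0_abs//.
  apply/eqP; rewrite eq_le; apply/andP; split; last first.
    by apply: integral_ge0 => x /h0/ltW.
  by rewrite integralB// sube_le0 fg.
move/ae_eq_integral_abs => /(_ mE) []; last move=> N [mN N0 EN].
  apply: emeasurable_funB.
  - exact: measurable_int intfE.
  - exact: measurable_int intgE.
apply/eqP; rewrite eq_le measure_ge0 andbT -N0 le_measure ?inE//.
apply: subset_trans EN => x Ex /= /(_ Ex) => e.
by have := h0 x Ex; rewrite e ltxx.
Qed.

End measure_comparison.

(** * A measure below a density *)

Section subgraph.
Context d (T : measurableType d) (R : realType).
Local Open Scope ereal_scope.

(** Integrating f over B amounts to measuring the part of this set that lies
    over B; the second coordinate stays in the measurable type that carries
    Lebesgue measure. *)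
Definition subgraph (f : T -> \bar R) : set (T * measurableTypeR R) :=
  [set p | (0 <= p.2)%R /\ p.2%:E < f p.1].

Lemma measurable_subgraph (f : T -> \bar R) : measurable_fun setT f ->
  measurable (subgraph f).
Proof.
move=> mf.
have -> : subgraph f = (setT `*` `[0%R, +oo[) `&`
    (setT `&` [set p : T * measurableTypeR R | p.2%:E < f p.1]).
  apply/seteqP; split=> -[x w] /=; rewrite in_itv/= andbT.
    by move=> [w0 wf].
  by move=> [[_ w0] [_ wf]].
apply: measurableI; first exact: measurableX.
apply: measurable_lte => //.
- by apply: measurableT_comp => //; exact: measurable_snd.
- by apply: (measurableT_comp mf); exact: measurable_fst.
Qed.

Lemma measure_subgraph (mu : {measure set T -> \bar R}) (f : T -> \bar R)
    (B : set T) :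
  measurable_fun setT f -> (forall x, 0 <= f x) ->
  (forall x, f x \is a fin_num) -> measurable B ->
  (mu \x (@lebesgue_measure R)) (subgraph f `&` B `*` setT) =
  \int[mu]_(x in B) f x.
Proof.
move=> mf f0 ffin mB; rewrite /product_measure1 [RHS]integral_mkcond.
apply: eq_integral => x _ /=; rewrite patchE.
case: ifPn => [|] xB.
  have -> : xsection (subgraph f `&` B `*` setT) x = `[0%R, fine (f x)[%classic.
    apply/seteqP; split=> w; rewrite /xsection/= inE/= in_itv/=.
      by move=> [[w0 wf] _]; rewrite w0/= -lte_fin fineK.
    move=> /andP[w0 wf]; split; last by rewrite inE in xB.
    by split => //; rewrite -(fineK (ffin x)) lte_fin.
  rewrite lebesgue_measure_itv/= lte_fin.
  case: ltP => [|]; first by rewrite oppr0 adde0 fineK.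
  move=> fx0; have -> : f x = 0; last by [].
  by rewrite -(fineK (ffin x)); congr EFin; apply/eqP; rewrite eq_le fx0 fine_ge0.
have -> : xsection (subgraph f `&` B `*` setT) x = set0; last by rewrite measure0.
apply/seteqP; split=> // w; rewrite /xsection/= inE/=.
by move=> [_ []] /=; rewrite notin_setE in xB.
Qed.

End subgraph.

(** * First levels of an increasing family of densities *)

Section first_level.
Context d (T : measurableType d) (R : realType).
Local Open Scope ereal_scope.

(** For densities increasing with the level, this is the conditional quantile
    function: given x and w >= 0, the level at which f_q(x) first exceeds w. It
    is -oo or +oo when f_q(x) exceeds w for all rational q, or for none. *)
Definition first_level (f : rat -> T -> \bar R) (p : T * measurableTypeR R) :=
  ereal_inf [set (ratr q : R)%:E | q in [set q | subgraph (f q) p]].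

Lemma first_level_ltP (f : rat -> T -> \bar R) (y : \bar R) p :
  first_level f p < y <-> exists2 q, (ratr q)%:E < y & subgraph (f q) p.
Proof.
split=> [/ereal_inf_lt[_ [q fq <-] qy]|[q qy fq]]; first by exists q.
by apply: le_lt_trans qy; apply: ereal_inf_lbound; exists q.
Qed.

(** Strict sublevel sets are countable unions of subgraphs; this is why levels
    are restricted to the rationals. *)
Lemma measurable_first_level (f : rat -> T -> \bar R) :
  (forall q, measurable_fun setT (f q)) -> measurable_fun setT (first_level f).
Proof.
move=> mf; apply: (measurability _ (ErealGenInftyO.measurableE R)).
move=> _ [_ [y ->] <-]; rewrite setTI.
have -> : first_level f @^-1` `]-oo, y%:E[ =
    \bigcup_(q in [set q : rat | (ratr q)%:E < y%:E]) subgraph (f q).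
  apply/seteqP; split=> p /=; rewrite in_itv/=.
    by move/first_level_ltP => [q qy fq]; exists q.
  by move=> [q qy fq]; apply/first_level_ltP; exists q.
rewrite bigcup_mkcond; apply: bigcupT_measurable_rat => q.
by case: ifPn => // _; exact: measurable_subgraph.
Qed.

Section monotone_densities.
Variables (mu : {sigma_finite_measure set T -> \bar R}) (f : rat -> T -> \bar R).
Hypothesis mf : forall q, measurable_fun setT (f q).
Hypothesis f0 : forall q x, 0 <= f q x.
Hypothesis ffin : forall q x, f q x \is a fin_num.
Hypothesis fmono : forall p q, (p <= q)%R -> mu [set x | f q x < f p x] = 0.

Let M := mu \x @lebesgue_measure R.

Definition level_event (B : set T) (y : R) : set (T * measurableTypeR R) :=
  B `*` setT `&` [set p | first_level f p <= y%:E].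

Lemma measurable_level_event (B : set T) (y : R) :
  measurable B -> measurable (level_event B y).
Proof.
move=> mB; apply: measurableI; first exact: measurableX.
rewrite -[X in measurable X]setTI.
by apply: emeasurable_fun_infty_c => //; exact: measurable_first_level.
Qed.

(** Together with [level_event_le], this squeezes the mass of the event that the
    first level is at most y between the integrals of the densities of the
    rational levels on either side of y. *)
Lemma level_event_ge (B : set T) (y : R) (q : rat) : measurable B ->
  (ratr q <= y)%R -> \int[mu]_(x in B) f q x <= M (level_event B y).
Proof.
move=> mB qy; rewrite -measure_subgraph//.
apply: le_measure; rewrite ?inE.
- by apply: measurableI; [exact: measurable_subgraph|exact: measurableX].
- exact: measurable_level_event.
- move=> p [fp Bp]; split => //=.
  by apply: (@le_trans _ _ (ratr q)%:E) => //; apply: ereal_inf_lbound; exists q.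
Qed.

(** A first level below q puts the point under some f_p with p <= q; it is then
    under f_q unless x belongs to one of the countably many null sets where the
    densities fail to increase. *)
Lemma level_event_le (B : set T) (y : R) (q : rat) : measurable B ->
  (y < ratr q)%R -> M (level_event B y) <= \int[mu]_(x in B) f q x.
Proof.
move=> mB yq; rewrite -measure_subgraph//.
have mS : measurable (subgraph (f q) `&` B `*` setT).
  by apply: measurableI; [exact: measurable_subgraph|exact: measurableX].
apply: le_measure_negligible => //; first exact: measurable_level_event.
(* The null sets of the failures of monotonicity, reindexed by naturals. *)
pose N n := if (unpickle n : option rat) is Some p then
  if (p <= q)%R then [set x | f q x < f p x] else set0 else set0.
have mN n : measurable (N n).
  rewrite /N; case: unpickle => [p|] //; case: ifP => // _.
  by rewrite -[X in measurable X]setTI; exact: measurable_lte.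
have N0 n : mu (N n) = 0.
  rewrite /N; case: unpickle => [p|]; last by rewrite measure0.
  by case: ifP => pq; [exact: fmono|rewrite measure0].
have UN0 : mu (\bigcup_n N n) = 0.
  have mU : measurable (\bigcup_n N n) by exact: bigcupT_measurable.
  apply: (iffLR (negligibleP mu mU)).
  by apply: negligible_bigcup => n; exact: (iffRL (negligibleP mu (mN n)) (N0 n)).
exists (\bigcup_n N n `*` setT); split.
- by apply: measurableX => //; exact: bigcupT_measurable.
- transitivity (mu (\bigcup_n N n) * lebesgue_measure [set: measurableTypeR R]).
    by apply: product_measure1E => //; exact: bigcupT_measurable.
  by rewrite UN0 mul0e.
- move=> [x w] [[[Bx _] /= fy]] nS; split => //=.
  have : first_level f (x, w) < (ratr q)%:E.
    by apply: le_lt_trans fy _; rewrite lte_fin.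
  move/first_level_ltP => [p pq [/= w0 wp]].
  exists (pickle p); first exact: Logic.I.
  rewrite /N pickleK.
  have -> : (p <= q)%R by rewrite -(ler_rat R) ltW// -lte_fin.
  rewrite /= ltNge; apply/negP => fpq; apply: nS; split => //; split => //=.
  exact: lt_le_trans fpq.
Qed.

End monotone_densities.
End first_level.

(** * Disintegration of an increasing family of measures *)

Section coupling.
Context d (T : measurableType d) (R : realType).
Local Open Scope ereal_scope.

Lemma ratr_between (x y : R) : (x < y)%R -> exists q : rat, (x < ratr q < y)%R.
Proof. by move=> /rat_in_itvoo[q]; rewrite in_itv/=; exists q. Qed.

(** A family of measures that increases with y from mass 0 to mass 1 and is
    absolutely continuous with respect to mu is of the form
    P(B x ]-oo, y]), wherever it is right-continuous in y. The pair is built on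
    the product of mu and Lebesgue measure, keeping x and taking the first level
    at which the densities exceed the second coordinate. *)
Theorem coupling_of_monotone_family (mu : {sigma_finite_measure set T -> \bar R})
    (nu : R -> {finite_measure set T -> \bar R}) :
  (forall y, nu y `<< mu) ->
  (forall x y A, (x <= y)%R -> measurable A -> nu x A <= nu y A) ->
  nu y setT @[y --> -oo%R] --> 0 -> nu y setT @[y --> +oo%R] --> 1 ->
  exists P : probability (T * R)%type R, forall B y, measurable B ->
    nu x B @[x --> y^'+] --> nu y B -> P (B `*` `]-oo, y]) = nu y B.
Proof.
move=> numu nu_mono nuNy nuy.
have [g gP] := choice (fun y => radon_nikodym_sigma_finite (numu y)).
pose f q := g (ratr q : R).
have f0 q x : 0 <= f q x by have [h _ _ _] := gP (ratr q); exact: h.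
have ffin q x : f q x \is a fin_num by have [_ h _ _] := gP (ratr q); exact: h.
have intf q : mu.-integrable setT (f q) by have [_ _ h _] := gP (ratr q).
have mf q : measurable_fun setT (f q) by case/integrableP: (intf q).
have nuf q A : measurable A -> \int[mu]_(x in A) f q x = nu (ratr q) A.
  by have [_ _ _ h] := gP (ratr q) => mA; rewrite -h.
have fmono p q : (p <= q)%R -> mu [set x | f q x < f p x] = 0.
  move=> pq; apply: density_mono => // A mA.
  by rewrite !nuf// nu_mono// ler_rat.
pose M := mu \x @lebesgue_measure R.
have mE B y (mB : measurable B) : measurable (level_event f B y).
  exact: (measurable_level_event mf y).
(* The strict inequality leaves room for a rational level. *)
have hi B x y : measurable B -> (x < y)%R -> M (level_event f B x) <= nu y B.
  move=> mB /ratr_between[q /andP[xq qy]].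
  apply: (@le_trans _ _ (nu (ratr q) B)); last by rewrite nu_mono// ltW.
  by rewrite -nuf//; exact: level_event_le.
(* Levels slightly above y are used, then continuity from above. *)
have lo B y : measurable B -> nu y B <= M (level_event f B y).
  move=> mB; pose F n := level_event f B (y + n.+1%:R^-1)%R.
  have FE : level_event f B y = \bigcap_n F n.
    apply/seteqP; split=> [p [Bp py] n _|p Fp].
      by split => //=; apply: (le_trans py); rewrite lee_fin lerDl.
    split; first by have [] := Fp 0%N Logic.I.
    apply/lee_addgt0Pr => e e0 /=.
    have [n _ /(_ n (leqnn _)) ne] := near_infty_natSinv_lt (PosNum e0).
    have [_ /= /le_trans->//] := Fp n Logic.I.
    by rewrite -EFinD lee_fin lerD2l ltW.
  have mF n : measurable (F n) by exact: mE.
  have FM : M (F n) @[n --> \oo] --> M (level_event f B y).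
    rewrite FE; apply: nonincreasing_cvg_mu => //.
    - apply: (le_lt_trans (hi _ _ (y + 2)%R mB _)).
        by rewrite ltrD2l invr1 ltr1n.
      by rewrite ltey_eq fin_num_measure.
    - exact: bigcapT_measurable.
    - move=> m n mn; apply/subsetPset => p [Bp py]; split => //=.
      apply: (le_trans py); rewrite lee_fin lerD2l lef_pV2 ?posrE//.
      by rewrite ler_nat ltnS.
  apply: (cvge_to_ge FM); apply: nearW => n.
  have : (y < y + n.+1%:R^-1)%R by rewrite ltrDl.
  move=> /ratr_between[q /andP[yq qn]].
  apply: (@le_trans _ _ (nu (ratr q) B)); first by rewrite nu_mono// ltW.
  by rewrite -nuf//; apply: level_event_ge => //; exact: ltW.
have mY : measurable_fun setT (first_level f) by exact: measurable_first_level.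
(* The product measure may be infinite: only the part where the first level is
   finite carries the probability. *)
pose D := [set p | first_level f p \is a fin_num].
have mD : measurable D.
  by rewrite -[D]setTI; exact: emeasurable_fin_num.
have YNy : M.-negligible [set p | first_level f p = -oo].
  have mYNy : measurable [set p | first_level f p = -oo].
    rewrite [X in measurable X](_ : _ = setT `&` [set p | first_level f p <= -oo]).
      exact: emeasurable_fun_infty_c.
    rewrite setTI; apply/seteqP; split => p /=; first by move=> ->.
    by rewrite leeNy_eq => /eqP.
  apply/negligibleP => //; apply/eqP; rewrite eq_le measure_ge0 andbT.
  apply: (cvge_to_ge nuNy); apply: nearW => y.
  apply: le_trans (hi setT (y - 1)%R y measurableT _); last by rewrite ltrBlDr ltrDl.
  apply: le_measure; rewrite ?inE//; first exact: mE.
  by move=> p /= py; split => //=; rewrite py leNye.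
have MED B y : measurable B -> M (level_event f B y `&` D) = M (level_event f B y).
  move=> mB; have mEB := mE B y mB.
  apply/eqP; rewrite eq_le; apply/andP; split.
    by apply: le_measure; rewrite ?inE//; exact: measurableI.
  apply: le_measure_negligible => //; first exact: measurableI.
  apply: negligibleS YNy => p [[Bp /= py] nD]; apply: contrapT => /eqP pNy.
  apply: nD; split; first by split.
  by rewrite /D/= fin_numE pNy/= lt_eqF// (le_lt_trans py)// ltry.
(* The mass of D is the limit of the masses of the first levels at most n,
   which lie between nu n setT and nu n.+1 setT. *)
have MD1 : M D = 1.
  have limM : M (level_event f setT n%:R `&` D) @[n --> \oo] --> M D.
    have DE : D = \bigcup_n (level_event f setT n%:R `&` D).
      apply/seteqP; split=> [p Dp|p [n _ [_ //]]].
      exists (Num.truncn (fine (first_level f p))).+1 => //; split => //; split => //=.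
      by rewrite -(fineK Dp) lee_fin ltW// truncnS_gt.
    rewrite [X in _ --> M X]DE.
    apply: nondecreasing_cvg_mu.
    - by move=> n; apply: measurableI => //; exact: mE.
    - by apply: bigcupT_measurable => n; apply: measurableI => //; exact: mE.
    - move=> m n mn; apply/subsetPset => p [[Bp py] Dp]; split => //; split => //=.
      by apply: (le_trans py); rewrite lee_fin ler_nat.
  have nun : nu n%:R setT @[n --> \oo] --> 1.
    by move/cvge_pinftyP : nuy; apply; exact/cvgryPge/nbhs_infty_ger.
  have {}limM : M (level_event f setT n%:R) @[n --> \oo] --> M D.
    by apply: cvg_trans limM; apply: near_eq_cvg; apply: nearW => n; rewrite MED.
  apply: (cvg_unique _ limM) => //.
  apply: (@squeeze_cvge _ _ _ _ (fun n : nat => nu n%:R setT) _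
    (fun n : nat => nu (n.+1)%:R setT)) => //.
  - apply: nearW => n; rewrite lo//= hi//.
    by rewrite ltr_nat.
  - by rewrite -(cvg_shiftS (fun n : nat => nu n%:R setT)) in nun.
have QT : mrestr M mD setT = 1 by rewrite /mrestr setTI.
pose Q : probability (T * measurableTypeR R)%type R :=
  HB.pack (mrestr M mD) (@Measure_isProbability.Build _ _ _ (mrestr M mD) QT).
pose phi p : T * R := (p.1, fine (first_level f p)).
have mphi : measurable_fun setT phi.
  apply: measurable_fun_pair; first exact: measurable_fst.
  exact: measurableT_comp mY.
pose X : {mfun (T * measurableTypeR R)%type >-> (T * R)%type} :=
  HB.pack phi (@isMeasurableFun.Build _ _ _ _ phi mphi).
exists (distribution Q X) => B y mB nuBy.
transitivity (M (level_event f B y `&` D)).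
  rewrite /distribution /pushforward /= /mrestr; congr (M _).
  apply/seteqP; split=> -[x w] /=; rewrite in_itv/=.
    by move=> [[Bx py] Dp]; split => //; split => //=; rewrite -(fineK Dp) lee_fin.
  by move=> [[[Bx _] py] Dp]; split => //; split => //=; rewrite -lee_fin fineK.
rewrite MED//; apply/eqP; rewrite eq_le lo// andbT.
apply: (cvge_to_ge nuBy); near=> y'.
by apply: hi => //; near: y'; exact: nbhs_right_gt.
Unshelve. all: by end_near. Qed.

End coupling.

(** * Lebesgue-Stieltjes measures *)

Section lebesgue_stieltjes.
Context {R : realType}.
Local Open Scope ereal_scope.

(** The measure is an infimum over coverings by half-open intervals of sums of
    increments, and is thus monotone in the increments. *)
Lemma lebesgue_stieltjes_mono (f g : cumulative R R) :
  (forall x y, (x <= y)%R -> (f y - f x <= g y - g x)%R) ->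
  forall A, lebesgue_stieltjes_measure f A <= lebesgue_stieltjes_measure g A.
Proof.
move=> fg A; rewrite /lebesgue_stieltjes_measure /measure_extension /mu_ext.
apply: le_ereal_inf_tmp => _ [F [mF AF] <-].
apply: (@le_trans _ _ (\sum_(k <oo) wlength f (F k))).
  by apply: ereal_inf_lbound; exists F.
apply: lee_nneseries => [k _ _|k _]; first exact: wlength_ge0.
have [[a b] _ <-] := mF k => /=.
have [ab|ba] := leP a b; last first.
  by rewrite set_itv_ge ?wlength0// bnd_simp -leNgt ltW.
by rewrite !wlength_itv_bnd// lee_fin fg.
Qed.

Lemma lebesgue_stieltjes_ray (f : cumulative R R) (r : R) :
  f x @[x --> -oo%R] --> 0%R ->
  lebesgue_stieltjes_measure f `]-oo, r]%classic = (f r)%:E.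
Proof.
move=> f0; pose F n : set R := `](r - n%:R)%R, r]%classic.
have UF : `]-oo, r]%classic = \bigcup_n F n.
  apply/seteqP; split=> [x /=|x [n _]]; rewrite /F/= !in_itv/=; last by case/andP.
  move=> xr; exists (Num.truncn (r - x)%R).+1 => //=.
  by rewrite in_itv/= xr andbT ltrBlDr -ltrBlDl truncnS_gt.
have lim1 : lebesgue_stieltjes_measure f (F n) @[n --> \oo] -->
    lebesgue_stieltjes_measure f `]-oo, r]%classic.
  rewrite UF; apply: nondecreasing_cvg_mu.
  - by move=> n; exact: measurable_itv.
  - by apply: bigcupT_measurable => n; exact: measurable_itv.
  - move=> m n mn; apply/subsetPset => x; rewrite /F/= !in_itv/= => /andP[mx ->].
    by rewrite andbT; apply: le_lt_trans mx; rewrite lerD2l lerN2 ler_nat.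
have lim2 : lebesgue_stieltjes_measure f (F n) @[n --> \oo] --> (f r)%:E.
  have -> : (fun n => lebesgue_stieltjes_measure f (F n)) =
      (fun n => (f r - f (r - n%:R)%R)%:E).
    apply/funext => n.
    rewrite /lebesgue_stieltjes_measure /measure_extension/=.
    rewrite measurable_mu_extE/=; last exact: is_ocitv.
    by rewrite wlength_itv_bnd// lerBlDr lerDl.
  apply/fine_cvgP; split; first exact: nearW.
  rewrite -[X in _ --> X]subr0; apply: cvgB; first exact: cvg_cst.
  apply: (cvg_comp _ _ _ f0).
  apply/cvgrNyPle => A; near=> n.
  rewrite lerBlDr -lerBlDl; near: n; exact: nbhs_infty_ger.
by apply: (cvg_unique _ lim1 lim2).
Unshelve. all: by end_near. Qed.

Lemma lebesgue_stieltjes_setT (f : cumulative R R) (l : R) :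
  f x @[x --> -oo%R] --> 0%R -> f x @[x --> +oo%R] --> l ->
  lebesgue_stieltjes_measure f setT = l%:E.
Proof.
move=> f0 fl; pose F n : set R := `]-oo, n%:R]%classic.
have UF : [set: R] = \bigcup_n F n.
  apply/seteqP; split=> // x _; exists (Num.truncn x).+1 => //=.
  by rewrite /F/= in_itv/= ltW// truncnS_gt.
have lim1 : lebesgue_stieltjes_measure f (F n) @[n --> \oo] -->
    lebesgue_stieltjes_measure f [set: R].
  rewrite UF; apply: nondecreasing_cvg_mu.
  - by move=> n; exact: measurable_itv.
  - by apply: bigcupT_measurable => n; exact: measurable_itv.
  - move=> m n mn; apply/subsetPset => x; rewrite /F/= !in_itv/= => xm.
    by apply: (le_trans xm); rewrite ler_nat.
have lim2 : lebesgue_stieltjes_measure f (F n) @[n --> \oo] --> l%:E.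
  under eq_fun do rewrite lebesgue_stieltjes_ray//.
  apply/fine_cvgP; split; first exact: nearW.
  apply: (cvg_comp _ _ _ fl); exact: cvgr_idn.
by apply: (cvg_unique _ lim1 lim2).
Qed.

End lebesgue_stieltjes.

(** * Existence of the law with distribution function C(F(x), G(y)) *)

Section copula_law.
Context {R : realType}.

Lemma cdf_bounds (F : cumulativeBounded (0 : R) (1 : R)) (x : R) : 0 <= F x <= 1.
Proof.
apply/andP; split.
  apply: (cvgr_to_le (cumulativeNy F)); near=> y.
  apply: cumulative_is_nondecreasing; apply: ltW.
  by near: y; exact: nbhs_ninfty_lt.
apply: (cvgr_to_ge (cumulativey F)); near=> y.
apply: cumulative_is_nondecreasing; apply: ltW.
by near: y; exact: nbhs_pinfty_gt.
Unshelve. all: by end_near. Qed.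

Variables (F G : cumulativeBounded (0 : R) (1 : R)) (C : R -> R -> R).
Hypothesis cC : is_copula C.

Let H x y := C (F x) (G y).

(* Right-continuity of H in either variable is inherited from F and G
   through the Lipschitz bound. *)
Let H_bounds x1 x2 y1 y2 : x1 <= x2 -> y1 <= y2 ->
  H x1 y1 <= H x2 y2 <= H x1 y1 + (F x2 - F x1) + (G y2 - G y1).
Proof.
move=> x12 y12.
have /andP[Fx1 _] := cdf_bounds F x1; have /andP[_ Fx2] := cdf_bounds F x2.
have /andP[Gy1 _] := cdf_bounds G y1; have /andP[_ Gy2] := cdf_bounds G y2.
have F12 : F x1 <= F x2 by exact: cumulative_is_nondecreasing.
have G12 : G y1 <= G y2 by exact: cumulative_is_nondecreasing.
apply/andP; split; first exact: (copula_nondecreasing cC).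
have := copula_lipschitz cC Fx1 F12 Fx2 Gy1 G12 Gy2.
by rewrite -/(H x2 y2) -/(H x1 y1); lra.
Qed.

Let H_nd y : nondecreasing (H ^~ y).
Proof. by move=> x1 x2 x12; have /andP[] := H_bounds x12 (lexx y). Qed.

Let H_rc y : right_continuous (H ^~ y).
Proof.
move=> x.
apply: (@squeeze_cvgr _ _ _ _ (fun=> H x y) (fun x' => H x y + (F x' - F x))).
- near=> x'; have xx' : x <= x' by apply: ltW; near: x'; exact: nbhs_right_gt.
  by have := H_bounds xx' (lexx y); rewrite subrr addr0.
- exact: cvg_cst.
- have : H x y + (F x' - F x) @[x' --> x^'+] --> H x y + (F x - F x).
    apply: cvgD; first exact: cvg_cst.
    by apply: cvgB; [exact: cumulative_is_right_continuous|exact: cvg_cst].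
  by rewrite subrr addr0.
Unshelve. all: by end_near. Qed.

Let H_rcr x y : H x y' @[y' --> y^'+] --> H x y.
Proof.
apply: (@squeeze_cvgr _ _ _ _ (fun=> H x y) (fun y' => H x y + (G y' - G y))).
- near=> y'; have yy' : y <= y' by apply: ltW; near: y'; exact: nbhs_right_gt.
  by have := H_bounds (lexx x) yy'; rewrite subrr addr0.
- exact: cvg_cst.
- have : H x y + (G y' - G y) @[y' --> y^'+] --> H x y + (G y - G y).
    apply: cvgD; first exact: cvg_cst.
    by apply: cvgB; [exact: cumulative_is_right_continuous|exact: cvg_cst].
  by rewrite subrr addr0.
Unshelve. all: by end_near. Qed.

(* The Frechet-Hoeffding bounds, which give the limits of H at infinity. *)
Let H_marginal x y : Num.max (F x + G y - 1) 0 <= H x y <= Num.min (F x) (G y).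
Proof.
have Fx := cdf_bounds F x; have Gy := cdf_bounds G y.
have /andP[Fx0 Fx1] := Fx; have /andP[Gy0 Gy1] := Gy.
have FG := copula_lipschitz cC Fx0 Fx1 (lexx 1) Gy0 (lexx (G y)) Gy1.
rewrite (copula_1 cC Gy).2 -/(H x y) in FG.
have HG := copula_nondecreasing cC Fx0 Fx1 (lexx 1) Gy0 (lexx (G y)) Gy1.
rewrite (copula_1 cC Gy).2 -/(H x y) in HG.
have HF := copula_nondecreasing cC Fx0 (lexx (F x)) Fx1 Gy0 Gy1 (lexx 1).
rewrite (copula_1 cC Fx).1 -/(H x y) in HF.
have /andP[H0 _] := copula_range cC Fx Gy.
rewrite -/(H x y) in H0.
by rewrite ge_max le_min H0 HF HG; lra.
Qed.

Let HNy y : H x y @[x --> -oo] --> 0.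
Proof.
apply: (@squeeze_cvgr _ _ _ _ (fun=> 0) F); last exact: cumulativeNy.
  apply: nearW => x; have := H_marginal x y.
  by rewrite ge_max le_min => /andP[/andP[_ ->] /andP[->]].
exact: cvg_cst.
Qed.

Let Hy y : H x y @[x --> +oo] --> G y.
Proof.
apply: (@squeeze_cvgr _ _ _ _ (fun x => F x + G y - 1) (fun=> G y)).
- apply: nearW => x; have := H_marginal x y.
  by rewrite ge_max le_min => /andP[/andP[-> _] /andP[_ ->]].
- rewrite -[X in _ --> X](addrK 1) [G y + 1]addrC.
  apply: cvgB; last exact: cvg_cst.
  by apply: cvgD; [exact: cumulativey|exact: cvg_cst].
- exact: cvg_cst.
Qed.

Let Hyr x : H x y @[y --> +oo] --> F x.
Proof.
apply: (@squeeze_cvgr _ _ _ _ (fun y => F x + G y - 1) (fun=> F x)).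
- apply: nearW => y; have := H_marginal x y.
  by rewrite ge_max le_min => /andP[/andP[-> _] /andP[->]].
- rewrite -[X in _ --> X](addrK 1).
  apply: cvgB; last exact: cvg_cst.
  by apply: cvgD; [exact: cvg_cst|exact: cumulativey].
- exact: cvg_cst.
Qed.

Let slice y : cumulative R R :=
  HB.pack (H ^~ y) (isCumulative.Build R _ R (H ^~ y) (@H_nd y) (@H_rc y)).

(* The 2-increasing property of C compares the increments of two slices. *)
Let slice_mono y1 y2 A : y1 <= y2 ->
  (lebesgue_stieltjes_measure (slice y1) A <=
   lebesgue_stieltjes_measure (slice y2) A)%E.
Proof.
move=> y12; apply: lebesgue_stieltjes_mono => x1 x2 x12 /=.
have /andP[Fx1 _] := cdf_bounds F x1; have /andP[_ Fx2] := cdf_bounds F x2.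
have /andP[Gy1 _] := cdf_bounds G y1; have /andP[_ Gy2] := cdf_bounds G y2.
have F12 : F x1 <= F x2 by exact: cumulative_is_nondecreasing.
have G12 : G y1 <= G y2 by exact: cumulative_is_nondecreasing.
have := copula_2increasing cC Fx1 F12 Fx2 Gy1 G12 Gy2.
by rewrite -/(H x2 y2) -/(H x1 y1) -/(H x1 y2) -/(H x2 y1); lra.
Qed.

(* Comparison with the upper edge v = 1, where C(u, 1) = u. *)
Let slice_dom y A : (lebesgue_stieltjes_measure (slice y) A <=
   lebesgue_stieltjes_measure F A)%E.
Proof.
apply: lebesgue_stieltjes_mono => x1 x2 x12 /=.
have Fx1 := cdf_bounds F x1; have Fx2 := cdf_bounds F x2.
have /andP[Gy1 Gy2] := cdf_bounds G y.
have F12 : F x1 <= F x2 by exact: cumulative_is_nondecreasing.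
have /andP[Fx10 _] := Fx1; have /andP[_ Fx21] := Fx2.
have := copula_2increasing cC Fx10 F12 Fx21 Gy1 Gy2 (lexx 1).
rewrite (copula_1 cC Fx1).1 (copula_1 cC Fx2).1.
by rewrite -/(H x2 y) -/(H x1 y); lra.
Qed.

Let slice_fin y : fin_num_fun (lebesgue_stieltjes_measure (slice y)).
Proof.
move=> A mA; rewrite ge0_fin_numE//.
apply: (@le_lt_trans _ _ (lebesgue_stieltjes_measure (slice y) setT)).
  by apply: le_measure; rewrite ?inE.
by rewrite (@lebesgue_stieltjes_setT _ (slice y) (G y) (HNy y) (@Hy y)) ltry.
Qed.

Let nu y : {finite_measure set (measurableTypeR R) -> \bar R} :=
  HB.pack_for (FiniteMeasure.type (measurableTypeR R) R)
    (lebesgue_stieltjes_measure (slice y))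
    (@Measure_isFinite.Build _ (measurableTypeR R) R
      (lebesgue_stieltjes_measure (slice y)) (slice_fin y)).

(** The slices H(., y) define measures that increase with y and are dominated by
    the law of F, so that they disintegrate. *)
Theorem copula_law_exists : exists P : probability (R * R)%type R,
  has_joint_cdf P (fun x y => C (F x) (G y)).
Proof.
have nuT y : nu y setT = (G y)%:E.
  exact: (@lebesgue_stieltjes_setT _ (slice y) (G y) (HNy y) (@Hy y)).
have [||||Q QE] := @coupling_of_monotone_family _ (measurableTypeR R) R
    (lebesgue_stieltjes_measure F) nu.
- move=> y; apply/null_content_dominatesP => A mA A0.
  apply/eqP; rewrite eq_le measure_ge0 andbT -A0; exact: slice_dom.
- by move=> y1 y2 A y12 _; exact: slice_mono.
- under eq_fun do rewrite nuT.
  by apply: cvg_EFin; [exact: nearW|exact: cumulativeNy].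
- under eq_fun do rewrite nuT.
  by apply: cvg_EFin; [exact: nearW|exact: cumulativey].
(* The identity, transporting the law between two presentations of the Borel
   sigma-algebra of the line. *)
pose phi (p : measurableTypeR R * R) : R * R := p.
have mphi : measurable_fun setT phi.
  apply/measurable_fun_pairP; split; first exact: measurable_fst.
  exact: measurable_snd.
pose X : {mfun (measurableTypeR R * R)%type >-> (R * R)%type} :=
  HB.pack phi (@isMeasurableFun.Build _ _ _ _ phi mphi).
exists (distribution Q X) => x y.
transitivity (Q (`]-oo, x] `*` `]-oo, y])); first by [].
have nuE y' : nu y' `]-oo, x]%classic = (H x y')%:E.
  exact: (@lebesgue_stieltjes_ray _ (slice y') x (HNy y')).
rewrite QE; first exact: nuE.
  exact: measurable_itv.
under eq_fun do rewrite nuE.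
by rewrite nuE; apply: cvg_EFin; [exact: nearW|exact: H_rcr].
Qed.

Lemma joint_law_cdf :
  has_joint_cdf (joint_law (fun x y => C (F x) (G y))) (fun x y => C (F x) (G y)).
Proof.
by apply: (@xgetPex _ _ [set P | has_joint_cdf P _]); exact: copula_law_exists.
Qed.

Lemma joint_cdf_margins (P : probability (R * R)%type R) :
  has_joint_cdf P (fun x y => C (F x) (G y)) -> has_margins P F G.
Proof.
move=> PH.
have iotay : (n%:R : R) @[n --> \oo] --> +oo%R by exact: cvgr_idn.
have Uy : [set: R] = \bigcup_n `]-oo, n%:R]%classic.
  apply/seteqP; split=> // x _; exists (Num.truncn x).+1 => //=.
  by rewrite in_itv/= ltW// truncnS_gt.
have mray (x : R) : measurable `]-oo, x]%classic by exact: measurable_itv.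
split=> x.
  have limP : P (`]-oo, x] `*` `]-oo, n%:R]) @[n --> \oo] --> P (`]-oo, x] `*` setT).
    rewrite [in X in _ --> X]Uy setX_bigcupr; apply: nondecreasing_cvg_mu.
    - by move=> n; exact: measurableX.
    - by apply: bigcupT_measurable => n; exact: measurableX.
    - move=> m n mn; apply/subsetPset => -[a b] /=; rewrite !in_itv/= => -[-> bm].
      by split => //; rewrite (le_trans bm)// ler_nat.
  have limH : (H x n%:R)%:E @[n --> \oo] --> (F x)%:E.
    apply: cvg_EFin; first exact: nearW.
    exact: (cvg_comp _ _ iotay (@Hyr x)).
  apply: (cvg_unique _ limP) => //; apply: cvg_trans limH.
  by apply: near_eq_cvg; apply: nearW => n; rewrite PH.
have limP : P (`]-oo, n%:R] `*` `]-oo, x]) @[n --> \oo] --> P (setT `*` `]-oo, x]).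
  rewrite [in X in _ --> X]Uy setX_bigcupl; apply: nondecreasing_cvg_mu.
  - by move=> n; exact: measurableX.
  - by apply: bigcupT_measurable => n; exact: measurableX.
  - move=> m n mn; apply/subsetPset => -[a b] /=; rewrite !in_itv/= => -[am ->].
    by split => //; rewrite (le_trans am)// ler_nat.
have limH : (H n%:R x)%:E @[n --> \oo] --> (G x)%:E.
  apply: cvg_EFin; first exact: nearW.
  exact: (cvg_comp _ _ iotay (@Hy x)).
apply: (cvg_unique _ limP) => //; apply: cvg_trans limH.
by apply: near_eq_cvg; apply: nearW => n; rewrite PH.
Qed.

End copula_law.

(** * Almost surely nested families *)

Section chains.
Context d (T : measurableType d) (R : realType).
Local Open Scope ereal_scope.

(** By induction, any finite union is almost surely contained in one of its
    members, whose mass is at most s; countable unions follow by continuity from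
    below. *)
Lemma measure_bigcup_chain (mu : {measure set T -> \bar R}) (I : countType)
    (D : set I) (q : I -> set T) (s : \bar R) :
  0 <= s -> (forall i, measurable (q i)) -> (forall i, D i -> mu (q i) <= s) ->
  (forall i j, D i -> D j ->
    mu.-negligible (q i `\` q j) \/ mu.-negligible (q j `\` q i)) ->
  mu (\bigcup_(i in D) q i) <= s.
Proof.
move=> s0 mq qs chain.
pose r n : set T := if (unpickle n : option I) is Some i then
  if `[< D i >] then q i else set0 else set0.
have rP n : r n = set0 \/ exists2 i, D i & r n = q i.
  rewrite /r; case: unpickle => [i|]; last by left.
  by case: asboolP => Di; [right; exists i|left].
have mr n : measurable (r n) by case: (rP n) => [->//|[i _ ->]].
have rs n : mu (r n) <= s by case: (rP n) => [->|[i Di ->]]; rewrite ?measure0 ?qs.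
have rchain m n : mu.-negligible (r m `\` r n) \/ mu.-negligible (r n `\` r m).
  case: (rP m) => [->|[i Di ->]].
    by left; rewrite set0D; exact: negligible_set0.
  case: (rP n) => [->|[j Dj ->]]; last exact: chain.
  by right; rewrite set0D; exact: negligible_set0.
have -> : \bigcup_(i in D) q i = \bigcup_n r n.
  apply/seteqP; split=> [x [i Di qx]|x [n _]].
    exists (pickle i); first exact: Logic.I.
    by rewrite /r pickleK asboolT.
  by case: (rP n) => [->//|[i Di ->]]; exists i.
pose B n := \big[setU/set0]_(i < n.+1) r i.
have mB n : measurable (B n) by exact: bigsetU_measurable.
have Bs n : exists k, mu.-negligible (B n `\` r k).
  elim: n => [|n [k IH]].
    exists 0%N; rewrite /B big_ord_recl big_ord0 setU0 setDv.
    exact: negligible_set0.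
  rewrite /B big_ord_recr/= -/(B n).
  have [h|h] := rchain k n.+1.
    exists n.+1; apply: negligibleS (negligibleU IH h).
    move=> x [[Bx|//] nx]; have [kx|kx] := pselect (r k x).
      by right.
    by left.
  exists k; apply: negligibleS (negligibleU IH h).
  by move=> x [[Bx|nx] kx]; [left|right].
rewrite -bigcup_bigsetU_bigcup.
have limB : mu (B n) @[n --> \oo] --> mu (\bigcup_n B n).
  apply: nondecreasing_cvg_mu => //; first exact: bigcupT_measurable.
  by move=> m n mn; apply/subsetPset; exact: subset_bigsetU.
apply: (cvge_to_le limB); apply: nearW => n.
have [k nk] := Bs n.
by apply: le_trans (rs k); exact: le_measure_negligible.
Qed.

End chains.

(** * Left limits, and the elementary lower bound *)

Section left_limits.
Context {R : realType}.
Variables (f : R -> R) (z b : R).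
Hypothesis f_nd : nondecreasing f.
Hypothesis f_bnd : forall x, f x <= b.

Lemma cvg_left_limit : f x @[x --> z^'-] --> left_limit f z.
Proof.
apply: nondecreasing_at_left_is_cvgr.
  by apply: nearW => x x1 x2 _ _; exact: f_nd.
by apply: nearW => x; exists b => _ [y _ <-].
Qed.

Lemma left_limit_ge y : y < z -> f y <= left_limit f z.
Proof.
move=> yz; apply: (cvgr_to_ge cvg_left_limit); near=> x.
by apply: f_nd; apply: ltW; near: x; exact: nbhs_left_gt.
Unshelve. all: by end_near. Qed.

Lemma left_limit_le c : (forall y, y < z -> f y <= c) -> left_limit f z <= c.
Proof.
move=> fc; apply: (cvgr_to_le cvg_left_limit); near=> x.
by apply: fc; near: x; exact: nbhs_left_lt.
Unshelve. all: by end_near. Qed.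

End left_limits.

Section makarov_bound.
Context {R : realType}.
Variables (F G : cumulativeBounded (0 : R) (1 : R)).

Lemma makarov_has_sup z :
  has_sup [set Num.max (F p.1 + G p.2 - 1) 0 | p in [set p : R * R | p.1 + p.2 = z]].
Proof.
split; first by exists (Num.max (F 0 + G z - 1) 0), (0, z) => //=; rewrite add0r.
exists 1 => _ [p _ <-].
have /andP[? ?] := cdf_bounds F p.1; have /andP[? ?] := cdf_bounds G p.2.
by rewrite ge_max ler01 andbT; lra.
Qed.

Lemma tau_W_ge x y : F x + G y - 1 <= tau_W F G (x + y).
Proof.
apply: (@le_trans _ _ (Num.max (F x + G y - 1) 0)); first by rewrite le_max lexx.
by apply: ub_le_sup; [exact: (makarov_has_sup _).2|exists (x, y)].
Qed.

Lemma tau_W_ge0 z : 0 <= tau_W F G z.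
Proof.
apply: (@le_trans _ _ (Num.max (F 0 + G z - 1) 0)); first by rewrite le_max lexx orbT.
apply: ub_le_sup; first exact: (makarov_has_sup _).2.
by exists (0, z) => //=; rewrite add0r.
Qed.

Lemma tau_W_le z c : 0 <= c -> (forall x y, x + y = z -> F x + G y - 1 <= c) ->
  tau_W F G z <= c.
Proof.
move=> c0 h; apply: ge_sup; first exact: (makarov_has_sup _).1.
by move=> _ [p pz <-]; rewrite ge_max c0 h.
Qed.

Lemma tau_W_le1 z : tau_W F G z <= 1.
Proof.
apply: tau_W_le => // x y _.
by have /andP[? ?] := cdf_bounds F x; have /andP[? ?] := cdf_bounds G y; lra.
Qed.

Lemma tau_W_nd : nondecreasing (tau_W F G).
Proof.
move=> z1 z2 z12; apply: tau_W_le; first exact: tau_W_ge0.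
move=> x y xy; apply: (@le_trans _ _ (F x + G (z2 - x) - 1)).
  rewrite lerB// lerD2l cumulative_is_nondecreasing//.
  by rewrite lerBrDl xy.
by have := tau_W_ge x (z2 - x); rewrite subrKC.
Qed.

Lemma measurable_sum_lt (z : R) : measurable [set p : R * R | p.1 + p.2 < z].
Proof.
rewrite -[X in measurable X]setTI.
have mD : measurable_fun setT (fun p : R * R => p.1 + p.2).
  by apply: measurable_funD; [exact: measurable_fst|exact: measurable_snd].
have := mD measurableT `]-oo, z[%classic (measurable_itv _).
by congr measurable; apply/seteqP; split=> p [_] /=; rewrite in_itv.
Qed.

Lemma measurable_sum_le (z : R) : measurable [set p : R * R | p.1 + p.2 <= z].
Proof.
rewrite -[X in measurable X]setTI.
have mD : measurable_fun setT (fun p : R * R => p.1 + p.2).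
  by apply: measurable_funD; [exact: measurable_fst|exact: measurable_snd].
have := mD measurableT `]-oo, z]%classic (measurable_itv _).
by congr measurable; apply/seteqP; split=> p [_] /=; rewrite in_itv.
Qed.

Definition quadrant (p : R * R) : set (R * R) := `]-oo, p.1] `*` `]-oo, p.2].

Lemma measurable_quadrant p : measurable (quadrant p).
Proof. by apply: measurableX; exact: measurable_itv. Qed.

Lemma quadrantP (p q : R * R) : quadrant p q <-> q.1 <= p.1 /\ q.2 <= p.2.
Proof. by rewrite /quadrant /= !in_itv. Qed.

(** The bound P(A) + P(B) - 1 for an intersection. *)
Lemma has_margins_quadrant (P : probability (R * R)%type R) x y :
  has_margins P F G -> ((F x + G y - 1)%:E <= P (quadrant (x, y)))%E.
Proof.
move=> [PF PG].
pose A : set (R * R) := `]-oo, x] `*` setT.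
pose B : set (R * R) := setT `*` `]-oo, y].
have mA : measurable A by apply: measurableX => //; exact: measurable_itv.
have mB : measurable B by apply: measurableX => //; exact: measurable_itv.
have -> : quadrant (x, y) = A `&` B.
  by rewrite /quadrant /A /B -setXI setIT setTI.
have : (P A <= P (A `&` B) + P (~` B))%E.
  rewrite (measureDI P mA mB) addeC leeD2l//.
  apply: le_measure; rewrite ?inE; [exact: measurableD|exact: measurableC|].
  by rewrite setDE; exact: subIsetr.
rewrite probability_setC// PF PG -EFinB.
have PABfin : P (A `&` B) \is a fin_num.
  by apply: fin_num_measure; exact: measurableI.
rewrite -(fineK PABfin) -EFinD !lee_fin; lra.
Qed.

Lemma tau_W_le_prob (P : probability (R * R)%type R) (E : set (R * R)) z :
  has_margins P F G -> measurable E -> [set p | p.1 + p.2 <= z] `<=` E ->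
  ((tau_W F G z)%:E <= P E)%E.
Proof.
move=> PFG mE zE; have PEfin : P E \is a fin_num by exact: fin_num_measure.
rewrite -(fineK PEfin) lee_fin; apply: tau_W_le; first exact: fine_ge0.
move=> x y xy; rewrite -lee_fin fineK//.
apply: (le_trans (has_margins_quadrant x y PFG)).
apply: le_measure; rewrite ?inE//; first exact: measurable_quadrant.
move=> p /quadrantP[/= px py]; apply: zE => /=.
by rewrite -xy lerD.
Qed.

(** * Events of small probability under the law of C_s *)

Section extremal.
Variables (s : R) (P : probability (R * R)%type R).
Hypothesis s01 : 0 <= s <= 1.
Hypothesis PC : has_joint_cdf P (fun x y => copula_t s (F x) (G y)).

Lemma extremal_quadrant p : F p.1 + G p.2 - 1 <= s ->
  P (quadrant p) = (Num.min (Num.min (F p.1) s) (Num.min (G p.2) s))%:E.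
Proof.
move=> ps; rewrite PC copula_tE//; try exact: cdf_bounds.
by congr EFin; rewrite (max_idPr _) ?addr0//; lra.
Qed.

(* If the corners are not ordered, the intersection is the quadrant with corner
   (p.1, q.2), whose mass is the smaller of min(F p.1, s) and min(G q.2, s):
   this is the mass of one of the two quadrants, which is thus almost surely
   contained in the other. *)
Let chain_lr p q : F p.1 + G p.2 - 1 <= s -> F q.1 + G q.2 - 1 <= s ->
  p.1 <= q.1 ->
  P.-negligible (quadrant p `\` quadrant q) \/
  P.-negligible (quadrant q `\` quadrant p).
Proof.
move=> ps qs pq1; have [pq2|qp2] := leP p.2 q.2.
  left; rewrite (_ : _ `\` _ = set0); first exact: negligible_set0.
  apply/seteqP; split=> // u [/quadrantP[u1 u2]]; case; apply/quadrantP.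
  by rewrite (le_trans u1 pq1) (le_trans u2 pq2).
have FM : F p.1 <= F q.1 by exact: cumulative_is_nondecreasing.
have GM : G q.2 <= G p.2 by apply: cumulative_is_nondecreasing; exact: ltW.
have I : quadrant p `&` quadrant q = quadrant (p.1, q.2).
  apply/seteqP; split=> u /=.
    by move=> [/quadrantP[u1 _] /quadrantP[_ u2]]; apply/quadrantP.
  move=> /quadrantP[/= u1 u2]; split; apply/quadrantP; split => //.
    by apply: (le_trans u2); exact: ltW.
  exact: (le_trans u1).
have mp := measurable_quadrant p; have mq := measurable_quadrant q.
have Ifin : P (quadrant p `&` quadrant q) \is a fin_num.
  by apply: fin_num_measure; exact: measurableI.
have PI : P (quadrant p `&` quadrant q) =
    (Num.min (Num.min (F p.1) s) (Num.min (G q.2) s))%:E.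
  by rewrite I extremal_quadrant//=; lra.
have null (A B : set (R * R)) : measurable A -> measurable B ->
    P (A `&` B) \is a fin_num -> P A = P (A `&` B) -> P.-negligible (A `\` B).
  move=> mA mB fAB; rewrite (measureDI P mA mB) => e.
  apply/negligibleP; first exact: measurableD.
  by have := addeK (P (A `\` B)) fAB; rewrite e subee.
have FMs : Num.min (F p.1) s <= Num.min (F q.1) s.
  by rewrite le_min !ge_min lexx FM orbT.
have GMs : Num.min (G q.2) s <= Num.min (G p.2) s.
  by rewrite le_min !ge_min lexx GM orbT.
have [le|/ltW le] := leP (Num.min (F p.1) s) (Num.min (G q.2) s); [left|right].
  apply: null => //; rewrite PI extremal_quadrant//; congr EFin.
  by rewrite (min_idPl le) (min_idPl (le_trans le GMs)).
rewrite setIC in Ifin PI; apply: null => //.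
rewrite PI extremal_quadrant//; congr EFin.
by rewrite (min_idPr le) (min_idPr (le_trans le FMs)).
Qed.

(** Quadrants with corners where F + G - 1 <= s are almost surely nested and
    have mass at most s. *)
Lemma extremal_bigcup (I : countType) (D : set I) (c : I -> R * R)
    (E : set (R * R)) :
  (forall i, D i -> F (c i).1 + G (c i).2 - 1 <= s) -> measurable E ->
  E `<=` \bigcup_(i in D) quadrant (c i) -> (P E <= s%:E)%E.
Proof.
move=> Ds mE Ec; have /andP[s0 _] := s01.
apply: (@le_trans _ _ (P (\bigcup_(i in D) quadrant (c i)))).
  apply: le_measure; rewrite ?inE//.
  rewrite bigcup_mkcond; apply: countable_bigcupT_measurable => //.
  by move=> i; case: ifPn => // _; exact: measurable_quadrant.
apply: measure_bigcup_chain => //.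
- by move=> i; exact: measurable_quadrant.
- move=> i Di; have : (P (quadrant (c i)) <= s%:E)%E; last by [].
  by rewrite extremal_quadrant ?Ds// lee_fin !ge_min lexx orbT.
- move=> i j Di Dj; have [ij|/ltW ji] := leP (c i).1 (c j).1.
    by apply: chain_lr; rewrite ?Ds.
  by rewrite or_comm; apply: chain_lr; rewrite ?Ds.
Qed.

End extremal.

End makarov_bound.

(** * Coverings, and sharpness of the bound *)

Section sharpness.
Context {R : realType}.
Variables (F G : cumulativeBounded (0 : R) (1 : R)).

Lemma rational_corner_lt (x y z : R) : x + y < z ->
  exists ab : rat * rat, [/\ x <= ratr ab.1, y <= ratr ab.2 &
    ratr ab.1 + ratr ab.2 < z].
Proof.
move=> xyz; have e0 : 0 < (z - x - y) / 2 by lra.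
have [|a /andP[xa ax]] := @ratr_between R x (x + (z - x - y) / 2).
  by rewrite ltrDl.
have [|b /andP[yb bx]] := @ratr_between R y (y + (z - x - y) / 2).
  by rewrite ltrDl.
by exists (a, b) => /=; split; [exact: ltW|exact: ltW|lra].
Qed.

(** This uses right-continuity of F and G: moving to a rational corner further up
    and to the right costs arbitrarily little. *)
Lemma rational_corner (x y s : R) : F x + G y - 1 < s ->
  exists ab : rat * rat, [/\ x <= ratr ab.1, y <= ratr ab.2 &
    F (ratr ab.1) + G (ratr ab.2) - 1 <= s].
Proof.
move=> xys; have e0 : 0 < (s - (F x + G y - 1)) / 2 by lra.
have [d Fd] : exists d : {posnum R},
    F (x + d%:num) <= F x + (s - (F x + G y - 1)) / 2.
  exact: nondecreasing_right_continuousP.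
have [d' Gd] : exists d : {posnum R},
    G (y + d%:num) <= G y + (s - (F x + G y - 1)) / 2.
  exact: nondecreasing_right_continuousP.
have [|a /andP[xa ax]] := @ratr_between R x (x + d%:num); first by rewrite ltrDl.
have [|b /andP[yb bx]] := @ratr_between R y (y + d'%:num); first by rewrite ltrDl.
have Fa : F (ratr a) <= F (x + d%:num).
  by apply: cumulative_is_nondecreasing; exact: ltW.
have Gb : G (ratr b) <= G (y + d'%:num).
  by apply: cumulative_is_nondecreasing; exact: ltW.
by exists (a, b) => /=; split; [exact: ltW|exact: ltW|lra].
Qed.

Let t z := tau_W F G z.
Let tstar z := left_limit (tau_W F G) z.

Let corner (ab : rat * rat) : R * R := (ratr ab.1, ratr ab.2).

Let tstar_ge y z : y < z -> t y <= tstar z.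
Proof. exact: (left_limit_ge (tau_W_nd F G) (tau_W_le1 F G)). Qed.

Let tstar_le z c : (forall y, y < z -> t y <= c) -> tstar z <= c.
Proof. exact: (left_limit_le (tau_W_nd F G) (tau_W_le1 F G)). Qed.

Lemma makarov_left_bounds z : 0 <= tstar z <= t z.
Proof.
apply/andP; split.
  apply: (@le_trans _ _ (t (z - 1))); first exact: tau_W_ge0.
  by apply: tstar_ge; rewrite ltrBlDr ltrDl.
by apply: tstar_le => y yz; apply: tau_W_nd; exact: ltW.
Qed.

Lemma makarov_left_01 z : 0 <= tstar z <= 1.
Proof.
have /andP[-> /le_trans->//] := makarov_left_bounds z.
exact: tau_W_le1.
Qed.

Lemma extremal_lt (P : probability (R * R)%type R) z :
  has_joint_cdf P (fun x y => copula_t (tstar z) (F x) (G y)) ->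
  P [set p | p.1 + p.2 < z] = (tstar z)%:E.
Proof.
move=> PH; have t01 := makarov_left_01 z.
have mE := @measurable_sum_lt R z.
apply/eqP; rewrite eq_le; apply/andP; split.
  apply: (extremal_bigcup t01 PH (D := [set ab | (corner ab).1 + (corner ab).2 < z])
    (c := corner)) => //.
    move=> ab /= abz; apply: le_trans (tau_W_ge F G _ _) _; exact: tstar_ge.
  move=> [x y] /= /rational_corner_lt[ab [xa yb abz]].
  by exists ab => //; apply/quadrantP.
have PEfin : P [set p | p.1 + p.2 < z] \is a fin_num by exact: fin_num_measure.
rewrite -(fineK PEfin) lee_fin; apply: tstar_le => y yz.
rewrite -lee_fin fineK//; apply: tau_W_le_prob => //.
  exact: (joint_cdf_margins (copula_t_copula t01) PH).
by move=> p /= /le_lt_trans; apply.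
Qed.

Lemma extremal_le (P : probability (R * R)%type R) z s :
  t z < s <= 1 -> has_joint_cdf P (fun x y => copula_t s (F x) (G y)) ->
  (P [set p | (p.1 + p.2 <= z)%R] <= s%:E)%E.
Proof.
move=> /andP[ts s1] PH.
have s01 : 0 <= s <= 1 by rewrite s1 andbT (le_trans (tau_W_ge0 F G z))// ltW.
apply: (extremal_bigcup s01 PH
  (D := [set ab | F (corner ab).1 + G (corner ab).2 - 1 <= s]) (c := corner)) => //.
  exact: measurable_sum_le.
move=> [x y] /= xyz.
have : F x + G y - 1 < s.
  apply: le_lt_trans (tau_W_ge F G _ _) (le_lt_trans _ ts); exact: tau_W_nd.
move=> /rational_corner[ab [xa yb abs]].
by exists ab => //; apply/quadrantP.
Qed.

(** At a point x where F(x) + G(z - x) - 1 attains tau_W(z), moving x to the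
    left brings the value down to tau_W(z-) at most, so that F jumps at x by
    the size of the jump of tau_W at least. Such points are therefore
    determined by the integer part of F(x) divided by this size, and this
    integer serves as their index in a countable covering. *)
Lemma extremal_le_jump (P : probability (R * R)%type R) z :
  tstar z < t z -> has_joint_cdf P (fun x y => copula_t (t z) (F x) (G y)) ->
  (P [set p | (p.1 + p.2 <= z)%R] <= (t z)%:E)%E.
Proof.
move=> jump PH; pose del := t z - tstar z.
have del0 : 0 < del by rewrite subr_gt0.
have t01 : 0 <= t z <= 1 by rewrite tau_W_ge0 tau_W_le1.
pose atom x := F x + G (z - x) - 1 = t z.
have atom_lt x1 x2 : atom x2 -> x1 < x2 -> F x1 / del + 1 <= F x2 / del.
  move=> a2 x12; rewrite -[X in _ + X](divff (lt0r_neq0 del0)) -mulrDl.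
  rewrite ler_pM2r ?invr_gt0//.
  have : F x1 + G (z - x2) - 1 <= tstar z.
    by apply: le_trans (tau_W_ge F G _ _) _; apply: tstar_ge; lra.
  by move: a2; rewrite /atom /del; lra.
have atom_uniq x1 x2 : atom x1 -> atom x2 ->
    Num.floor (F x1 / del) = Num.floor (F x2 / del) -> x1 = x2.
  move=> a1 a2 e; apply/eqP; rewrite eq_le !leNgt.
  have /andP[l1 u1] := floor_itv (F x1 / del).
  have /andP[l2 u2] := floor_itv (F x2 / del).
  rewrite e in l1 u1; rewrite intrD in u1 u2.
  apply/andP; split; apply/negP.
    by move/(atom_lt _ _ a1); lra.
  by move/(atom_lt _ _ a2); lra.
(* Rational corners, together with one corner on the line x + y = z for each
   integer part; integers that no atom realizes yield the corner of an
   arbitrary abscissa, kept only if it lies in the region. *)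
pose c (i : (rat * rat + int)%type) : R * R := match i with
  | inl ab => corner ab
  | inr k => let x := xget 0 [set x | atom x /\ Num.floor (F x / del) = k] in
             (x, z - x)
  end.
apply: (extremal_bigcup t01 PH (D := [set i | F (c i).1 + G (c i).2 - 1 <= t z])
  (c := c)) => //; first exact: measurable_sum_le.
move=> [x y] /= xyz.
have : F x + G (z - x) - 1 <= t z.
  by have := tau_W_ge F G x (z - x); rewrite subrKC.
rewrite le_eqVlt => /predU1P[ax|].
  exists (inr (Num.floor (F x / del))); last first.
    apply/quadrantP => /=.
    case: xgetP => [x0 _ [ax0 /(atom_uniq _ _ ax0 ax) ->]|/(_ x) []//].
    by split=> //; lra.
  rewrite /= -[leRHS]ax.
  by case: xgetP => [x0 _ [ax0 /(atom_uniq _ _ ax0 ax) ->]|/(_ x) []//].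
move=> /rational_corner[ab [xa yb abt]].
by exists (inl ab) => //; apply/quadrantP; split => //=; apply: le_trans yb; lra.
Qed.

End sharpness.

(** * Consequences for sigma *)

Section sigma_bounds.
Context {R : realType}.
Variables (F G : cumulativeBounded (0 : R) (1 : R)).

Lemma sigmaE C z : (sigma C F G z)%:E =
  joint_law (fun x y => C (F x) (G y)) [set p | p.1 + p.2 <= z].
Proof. by rewrite /sigma fineK// fin_num_measure//; exact: measurable_sum_le. Qed.

Lemma sigma_ge C z : is_copula C -> tau_W F G z <= sigma C F G z.
Proof.
move=> cC; rewrite -lee_fin sigmaE; apply: tau_W_le_prob => //.
  exact: (joint_cdf_margins cC (joint_law_cdf F G cC)).
exact: measurable_sum_le.
Qed.

(** The copula C_s with s slightly above tau_W(z), or C_1 when tau_W(z) = 1 and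
    there is nothing to prove. *)
Lemma sigma_approx z e : 0 < e ->
  exists2 C, is_copula C & sigma C F G z <= tau_W F G z + e.
Proof.
move=> e0; have [t1|t1] := ltP (tau_W F G z) 1.
  pose s := Num.min (tau_W F G z + e) 1.
  have ts1 : tau_W F G z < s <= 1.
    by rewrite lt_min ltrDl e0 t1 ge_min lexx orbT.
  have s01 : 0 <= s <= 1.
    by move: ts1 => /andP[ts ->]; rewrite andbT (le_trans (tau_W_ge0 F G z))// ltW.
  exists (copula_t s); first exact: copula_t_copula.
  apply: (@le_trans _ _ s); last by rewrite ge_min lexx.
  rewrite -lee_fin sigmaE; apply: (extremal_le ts1).
  exact: (joint_law_cdf F G (copula_t_copula s01)).
have c1 : is_copula (copula_t (1 : R)) by apply: copula_t_copula; rewrite ler01 lexx.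
exists (copula_t 1) => //; apply: (@le_trans _ _ 1); last by lra.
by rewrite -lee_fin sigmaE probability_le1//; exact: measurable_sum_le.
Qed.

(** The copula does not vary with the argument, so that for x < z the value
    sigma(x) is a probability under a single law, squeezed between tau_W(x) and
    P(X + Y < z). *)
Lemma left_limit_sigma z : let tstar := left_limit (tau_W F G) z in
  left_limit (sigma (copula_t tstar) F G) z = tstar.
Proof.
move=> tstar; have ct := copula_t_copula (makarov_left_01 F G z).
apply: cvg_lim => //.
apply: (@squeeze_cvgr _ _ _ _ (tau_W F G) (fun=> tstar)).
- near=> x; rewrite sigma_ge//=.
  have xz : x < z by near: x; exact: nbhs_left_lt.
  rewrite -lee_fin sigmaE -(extremal_lt (joint_law_cdf F G ct)).
  apply: le_measure; rewrite ?inE; first exact: measurable_sum_le.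
    exact: measurable_sum_lt.
  by move=> p /= /le_lt_trans; apply.
- exact: (cvg_left_limit (tau_W_nd F G) (tau_W_le1 F G)).
- exact: cvg_cst.
Unshelve. all: by end_near. Qed.

Lemma sigma_jump z : left_limit (tau_W F G) z < tau_W F G z ->
  sigma (copula_t (tau_W F G z)) F G z = tau_W F G z.
Proof.
move=> jump.
have ct : is_copula (copula_t (tau_W F G z)).
  by apply: copula_t_copula; rewrite tau_W_ge0 tau_W_le1.
apply/eqP; rewrite eq_le sigma_ge// andbT -lee_fin sigmaE.
exact: (extremal_le_jump jump (joint_law_cdf F G ct)).
Qed.

End sigma_bounds.

Theorem theorem23 (R : realType) (F G : cumulativeBounded (0 : R) (1 : R))
    (z : R) :
  let t := tau_W F G z in
  let tstar := left_limit (tau_W F G) z in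
  (* (i) *)
  ([/\ is_copula (copula_t tstar),
       left_limit (sigma (copula_t tstar) F G) z = tstar &
       exists P : probability (R * R)%type R,
         has_margins P F G /\ P [set p | p.1 + p.2 < z] = tstar%:E]) /\
  (* (ii) *)
  (t = inf [set sigma C F G z | C in [set C | is_copula C]] /\
   t%:E = ereal_inf [set P [set p | p.1 + p.2 <= z] |
            P in [set P : probability (R * R)%type R | has_margins P F G]]) /\
  (* (iii) *)
  (tstar < t ->
   [/\ is_copula (copula_t t),
       sigma (copula_t t) F G z = t &
       (exists2 C, is_copula C & sigma C F G z = t) /\
       (forall C, is_copula C -> t <= sigma C F G z)]) /\
  (* (iv) *)
  ((~ (exists C, is_copula C /\ sigma C F G z = t) -> t = tstar) /\
   (~ (exists P : probability (R * R)%type R,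
         has_margins P F G /\ P [set p | p.1 + p.2 <= z] = t%:E) ->
    t = tstar)).
Proof.
move=> t tstar.
have ct : is_copula (copula_t t).
  by apply: copula_t_copula; rewrite tau_W_ge0 tau_W_le1.
have cts : is_copula (copula_t tstar) by exact/copula_t_copula/makarov_left_01.
have jump : tstar = t \/ tstar < t.
  have /andP[_] := makarov_left_bounds F G z.
  by rewrite le_eqVlt => /predU1P.
have law_margins C (cC : is_copula C) := joint_cdf_margins cC (joint_law_cdf F G cC).
split; [|split; [|split; [|split]]].
- split => //; first exact: left_limit_sigma.
  exists (joint_law (fun x y => copula_t tstar (F x) (G y))).
  by split; [exact: law_margins|exact: (extremal_lt (joint_law_cdf F G cts))].
- split.
    apply/eqP; rewrite eq_le; apply/andP; split.
      apply: lb_le_inf; first by exists (sigma (copula_t t) F G z), (copula_t t).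
      by move=> _ [C cC <-]; exact: sigma_ge.
    apply/ler_addgt0Pr => e e0; have [C cC Ce] := sigma_approx F G z e0.
    apply: le_trans Ce; apply: ge_inf; last by exists C.
    by exists t => _ [C' cC' <-]; exact: sigma_ge.
  apply/eqP; rewrite eq_le; apply/andP; split.
    apply: le_ereal_inf_tmp => _ [P PFG <-]; apply: tau_W_le_prob => //.
    exact: measurable_sum_le.
  apply/lee_addgt0Pr => e e0; have [C cC Ce] := sigma_approx F G z e0.
  apply: (@le_trans _ _ (sigma C F G z)%:E); last by rewrite -EFinD lee_fin.
  rewrite sigmaE; apply: ereal_inf_lbound.
  by exists (joint_law (fun x y => C (F x) (G y))) => //; exact: law_margins.
- move=> tst; have st := sigma_jump tst; split => //.
  by split; [exists (copula_t t)|move=> C; exact: sigma_ge].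
- move=> nC; case: jump => [->//|tst]; case: nC.
  by exists (copula_t t); split => //; exact: sigma_jump.
- move=> nP; case: jump => [->//|tst]; case: nP.
  exists (joint_law (fun x y => copula_t t (F x) (G y))).
  by split; [exact: law_margins|rewrite -sigmaE; congr EFin; exact: sigma_jump].
Qed.
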